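(* Let $R$ be a semiprime ring with an automorphism $\sigma$, let $n\geq 3$ be an integer, and let $\Delta: R\times R\times\cdots\times R\rightarrow R$ ($n$ arguments) be a skew $n$-derivation with respect to $\sigma$. Then $\Delta$ maps into the center of $R$, i.e. $\Delta(x_1,\ldots,x_n)\in Z(R)$ for all $x_1,\ldots,x_n\in R$.
   Context: Rings are associative; no identity element is assumed. A ring $R$ is semiprime if $aRa\neq 0$ for all $0\neq a\in R$. $Z(R)$ denotes the center of $R$. For an automorphism $\sigma$ of $R$, an additive map $\mu:R\to R$ is a $\sigma$-derivation if $\mu(xy)=\sigma(x)\mu(y)+\mu(x)y$ for all $x,y\in R$. A map $\Delta:R\times\cdots\times R\to R$ of $n$ arguments is a skew $n$-derivation with respect to $\sigma$ if it is a $\sigma$-derivation in each argument when the other $n-1$ arguments are fixed; that is, for every $i$ and all fixed $a_1,\ldots,a_{i-1},a_{i+1},\ldots,a_n\in R$ and all $x_i,y_i\in R$, $$\Delta(a_1,\ldots,x_i+y_i,\ldots,a_n)=\Delta(a_1,\ldots,x_i,\ldots,a_n)+\Delta(a_1,\ldots,y_i,\ldots,a_n),$$ $$\Delta(a_1,\ldots,x_iy_i,\ldots,a_n)=\Delta(a_1,\ldots,x_i,\ldots,a_n)y_i+\sigma(x_i)\Delta(a_1,\ldots,y_i,\ldots,a_n).$$ No symmetry of $\Delta$ in its arguments is assumed. *)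

(* Defs.v *)
From HB Require Import structures.
From mathcomp Require Import all_boot all_order all_algebra.

Set Implicit Arguments.
Unset Strict Implicit.
Unset Printing Implicit Defensive.

Import GRing.Theory.

Local Open Scope ring_scope.

(* Associative rings without an identity element: all the ring structures of
   the library are unital.  The product is the one of the semigroup structure;
   it gets its own notation because [*] in [ring_scope] is the product of the
   unital rings. *)
Notation "x ** y" := (monoid.mul x y) (at level 40, left associativity) : ring_scope.

HB.mixin Record isDistributive R of GRing.Zmodule R & Semigroup R := {
  mulgDl : forall x y z : R, (x + y) ** z = x ** z + y ** z;
  mulgDr : forall x y z : R, x ** (y + z) = x ** y + x ** z
}.

#[short(type="rngType")]
HB.structure Definition Rng :=
  { R of GRing.Zmodule R & Semigroup R & isDistributive R }.

Definition semiprime (R : rngType) : Prop :=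
  forall a : R, a != 0 -> exists x : R, a ** x ** a != 0.

Definition central (R : rngType) (z : R) : Prop :=
  forall x : R, z ** x = x ** z.

Definition automorphism (R : rngType) (sigma : R -> R) : Prop :=
  [/\ bijective sigma,
      {morph sigma : x y / x + y} &
      {morph sigma : x y / x ** y}].

Definition skew_derivation (R : rngType) (sigma mu : R -> R) : Prop :=
  {morph mu : x y / x + y} /\
  (forall x y : R, mu (x ** y) = sigma x ** mu y + mu x ** y).

Definition update (R : Type) (n : nat) (a : {ffun 'I_n -> R}) (i : 'I_n)
    (x : R) : {ffun 'I_n -> R} :=
  [ffun j => if j == i then x else a j].

(* The [i]-th component of [a] is overwritten by [update], so that quantifying
   over [a] amounts to fixing the other [n - 1] arguments. *)
Definition skew_n_derivation (R : rngType) (n : nat) (sigma : R -> R)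
    (Delta : {ffun 'I_n -> R} -> R) : Prop :=
  forall (i : 'I_n) (a : {ffun 'I_n -> R}),
    skew_derivation sigma (fun x : R => Delta (update a i x)).

(* Main.v *)
Require Import Defs.
From mathcomp Require Import all_boot all_order all_algebra.

(** Only three of the arguments matter, so let [F] be a skew 3-derivation.
Expanding [D (x ** y) (u ** v)] in the two possible orders shows that a map [D] which
is a [sigma]-derivation in each of two arguments satisfies
  [D x u ** z ** [y, v] = sigma ([x, u] ** z) ** D y v]
([biderivation_commutator_mul]), so [D x u] kills all [z ** [y, v]] as soon as
[x] and [u] commute.  In particular [F x x w ** z ** [y, v] = 0].  The same
identity for the biderivation [F x], evaluated at the first argument [x], turns
this into [sigma [x, w] ** r ** F x y v = 0].

The last relation is quadratic in [x], and in a semiprime ring the usual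
polarization argument makes it hold with two independent variables:
[sigma [x, w] ** r ** F x' y v = 0] ([annihilates_polarize]).  By the identity
above, every value of [F] then satisfies [F x u w ** z ** [y, v] = 0], and a
value [a] with [a ** R ** [R, R] = 0] is central, because
[[a, y] ** R ** [a, y] = 0] ([annihilates_commutators_central]). *)

Set Implicit Arguments.
Unset Strict Implicit.
Unset Printing Implicit Defensive.

Import GRing.Theory.
Local Open Scope ring_scope.

Section NonUnitalRing.
Variable R : rngType.
Implicit Types x y z : R.

Lemma mul0g x : 0 ** x = 0.
Proof. by apply: (addrI (0 ** x)); rewrite -mulgDl !addr0. Qed.

Lemma mulg0 x : x ** 0 = 0.
Proof. by apply: (addrI (x ** 0)); rewrite -mulgDr !addr0. Qed.

Lemma mulNg x y : (- x) ** y = - (x ** y).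
Proof. by apply: (addrI (x ** y)); rewrite -mulgDl !subrr mul0g. Qed.

Lemma mulgN x y : x ** (- y) = - (x ** y).
Proof. by apply: (addrI (x ** y)); rewrite -mulgDr !subrr mulg0. Qed.

Definition commutator x y := x ** y - y ** x.

Lemma commutatorDl x y z :
  commutator (x + y) z = commutator x z + commutator y z.
Proof. by rewrite /commutator mulgDl mulgDr opprD addrACA. Qed.

Lemma commutatorMl x y z :
  commutator (x ** y) z = x ** commutator y z + commutator x z ** y.
Proof.
by rewrite /commutator mulgDr mulgDl mulgN mulNg !mulgA addrA subrK.
Qed.

Lemma semiprime_eq0 (hR : semiprime R) x :
  (forall s, x ** s ** x = 0) -> x = 0.
Proof.
move=> x0; apply/eqP/negP => /negP /hR [s]; by rewrite x0 eqxx.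
Qed.

(** If [a ** R ** [R, R] = 0] then [[a, y] ** s ** [a, y] = 0]: expanding
the left-hand commutator leaves two terms, each with a factor
[a ** R ** [a, y]]. *)
Lemma annihilates_commutators_central (hR : semiprime R) (a : R) :
  (forall z y v, a ** z ** commutator y v = 0) -> central a.
Proof.
move=> a0 y; apply/subr0_eq/(semiprime_eq0 hR) => s.
rewrite -/(commutator a y) {1}/commutator !mulgDl !mulNg.
by rewrite -[a ** y ** s]mulgA a0 -2!mulgA [a ** _]mulgA a0 mulg0 subr0.
Qed.

(** Linearizing [f x ** r ** g x = 0] gives
[f x ** r ** g y = - f y ** r ** g x], so that
[(f x ** r ** g y) ** s ** (f x ** r ** g y)] begins with [f x] and, after this
exchange, ends with [g x]. *)
Lemma annihilates_polarize (hR : semiprime R) (f g : R -> R) :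
    {morph f : x y / x + y} -> {morph g : x y / x + y} ->
    (forall r x, f x ** r ** g x = 0) ->
  forall r x y, f x ** r ** g y = 0.
Proof.
move=> fD gD fg0 r x y; apply: (semiprime_eq0 hR) => s.
have exchange : f x ** r ** g y = - (f y ** r ** g x).
  apply/eqP; rewrite -addr_eq0; apply/eqP.
  have := fg0 r (x + y).
  by rewrite fD gD !mulgDl !mulgDr !fg0 add0r addr0.
rewrite {2}exchange mulgN.
have -> : f x ** r ** g y ** s ** (f y ** r ** g x)
          = f x ** (r ** g y ** s ** f y ** r) ** g x by rewrite !mulgA.
by rewrite fg0 oppr0.
Qed.

End NonUnitalRing.

Section SkewDerivations.
Variables (R : rngType) (sigma : R -> R).
Hypothesis hsigma : automorphism sigma.

Lemma automorphism0 : sigma 0 = 0.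
Proof.
by case: hsigma => _ sD _; apply: (addrI (sigma 0)); rewrite -sD !addr0.
Qed.

Lemma automorphismN x : sigma (- x) = - sigma x.
Proof.
case: hsigma => _ sD _; apply: (addrI (sigma x)).
by rewrite -sD !subrr automorphism0.
Qed.

Section Biderivation.
Variable D : R -> R -> R.
Hypotheses (D1 : forall u, skew_derivation sigma (D^~ u))
           (D2 : forall x, skew_derivation sigma (D x)).

(** Compare the two expansions of [D (x ** y) (u ** v)]; the two mixed
terms, [sigma u ** D x v ** y] and [sigma x ** D y u ** v], occur in both. *)
Lemma biderivation_commutator x u y v :
  D x u ** commutator y v = sigma (commutator x u) ** D y v.
Proof.
have [_ sD sM] := hsigma.
have M1 a b c : D (a ** b) c = sigma a ** D b c + D a c ** b.
  by have [_ ->] := D1 c.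
have M2 a b c : D a (b ** c) = sigma b ** D a c + D a b ** c.
  by have [_ ->] := D2 a.
have := M1 x y (u ** v).
rewrite /commutator !M2 !M1 !mulgDr !mulgDl !mulgA.
rewrite [LHS]addrACA [LHS]addrAC [RHS]addrAC => /addIr.
rewrite [LHS]addrCA [RHS]addrCA => /addrI E.
rewrite sD automorphismN !sM mulgDl mulgN mulNg !mulgA.
by apply/eqP; rewrite subr_eq addrAC eq_sym subr_eq -E addrC.
Qed.

(** Replacing [y] by [z ** y] in the previous identity inserts [z] on both
sides; the remaining terms cancel by the identity for [z]. *)
Lemma biderivation_commutator_mul x u z y v :
  D x u ** z ** commutator y v = sigma (commutator x u) ** sigma z ** D y v.
Proof.
have := biderivation_commutator x u (z ** y) v.
have [_ ->] := D1 v; rewrite commutatorMl !mulgDr !mulgA.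
by rewrite biderivation_commutator => /addIr.
Qed.

End Biderivation.

Section SkewTriderivation.
Hypothesis hR : semiprime R.
Variable F : R -> R -> R -> R.
Hypotheses (F1 : forall u w, skew_derivation sigma (fun x => F x u w))
           (F2 : forall x w, skew_derivation sigma (fun u => F x u w))
           (F3 : forall x u, skew_derivation sigma (fun w => F x u w)).

(** With the third argument fixed, [F] is a biderivation and
[commutator x x = 0]. *)
Lemma triderivation_diag x w z y v : F x x w ** z ** commutator y v = 0.
Proof.
rewrite (biderivation_commutator_mul (fun u => F1 u w) (fun x => F2 x w)).
by rewrite /commutator subrr automorphism0 !mul0g.
Qed.

Lemma triderivation_annihilates w y v r x x' :
  sigma (commutator x w) ** r ** F x' y v = 0.
Proof.
have [sbij sD _] := hsigma.
apply: (@annihilates_polarize _ hR (fun x => sigma (commutator x w))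
          (fun x => F x y v)) => [a b|a b|{}r {}x].
- by rewrite commutatorDl sD.
- by have [-> _] := F1 y v.
(* The biderivation is now [F x], whose first argument is set to [x] again. *)
have [tau _ tauK] := sbij.
rewrite -[r]tauK -(biderivation_commutator_mul (F2 x) (F3 x)).
exact: triderivation_diag.
Qed.

Lemma triderivation_central x u w : central (F x u w).
Proof.
apply: (annihilates_commutators_central hR) => z y v.
rewrite (biderivation_commutator_mul (fun u => F1 u w) (fun x => F2 x w)).
exact: triderivation_annihilates.
Qed.

End SkewTriderivation.
End SkewDerivations.

Section Update.
Variables (T : Type) (n : nat) (a : {ffun 'I_n -> T}).

Lemma update_id i : update a i (a i) = a.
Proof. by apply/ffunP => j; rewrite ffunE; case: eqP => [->|]. Qed.

Lemma updateC i j b c :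
  i != j -> update (update a i b) j c = update (update a j c) i b.
Proof.
move=> nij; apply/ffunP => k; rewrite !ffunE.
by case: (eqVneq k j) => // ->; rewrite eq_sym (negbTE nij).
Qed.

End Update.

Theorem theorem2p7 (R : rngType) (hR : semiprime R)
    (sigma : R -> R) (hsigma : automorphism sigma)
    (n : nat) (hn : (3 <= n)%N)
    (Delta : {ffun 'I_n -> R} -> R) (hDelta : skew_n_derivation sigma Delta)
    (x : {ffun 'I_n -> R}) :
  central (Delta x).
Proof.
have n1 := ltnW hn; have n0 := ltnW n1.
pose i := Ordinal n0; pose j := Ordinal n1; pose k := Ordinal hn.
pose F a b c := Delta (update (update (update x i a) j b) k c).
have -> : Delta x = F (x i) (x j) (x k) by rewrite /F !update_id.
apply: (triderivation_central hsigma hR) => b c; rewrite /skew_derivation /F.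
- have E a : update (update (update x i a) j b) k c
             = update (update (update x j b) k c) i a.
    by rewrite (@updateC _ _ x i) // updateC.
  have [D M] := hDelta i (update (update x j b) k c).
  by split => [p q|p q]; rewrite !E.
- have E a : update (update (update x i b) j a) k c
             = update (update (update x i b) k c) j a by rewrite updateC.
  have [D M] := hDelta j (update (update x i b) k c).
  by split => [p q|p q]; rewrite !E.
- exact: hDelta.
Qed.
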